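(* Let $A\subseteq 2^\omega$ be such that $2^\omega\setminus A$ is dense. Suppose $T_1$ and $T_2$ are consistent $L^d_A$-theories with vocabularies $\tau_1$ and $\tau_2$ respectively, such that $T_1\cap T_2$ is complete with respect to first-order logic in the vocabulary $\tau_1\cap\tau_2$ (for every first-order $\tau_1\cap\tau_2$-sentence $\varphi$, either $\varphi$ or $\neg\varphi$ follows from $T_1\cap T_2$). Then $T_1\cup T_2$ is consistent (has a model).
   Context: Let $\tau_d=\{R_0,R_1,R_2,R_3,R_4\}$ with $R_0,R_1,R_2$ binary and $R_3,R_4$ unary. For $n<\omega$ and $\eta\in 2^n$ let $\psi_\eta(x)$ be the first-order formula $R_4(x)\wedge\exists y_0\ldots\exists y_n\big(R_3(y_0)\wedge R_4(y_n)\wedge\bigwedge_{i<n}R_{\eta(i)}(y_i,y_{i+1})\wedge\bigwedge_{i\le n}R_2(y_i,x)\big)$. For a $\tau_d$-structure $\mathcal N$ and $a\in N$ let $\Omega(\mathcal N,a)=\{\eta\in 2^{<\omega}:\mathcal N\models\psi_\eta(a)\}$ and $\Omega(\mathcal N)=\{\eta\in 2^\omega:\exists a\in N\ \forall n<\omega\ \eta\restriction n\in\Omega(\mathcal N,a)\}$. $B\subseteq 2^\omega$ is dense if every $s\in 2^{<\omega}$ has an extension in $B$. For $A\subseteq 2^\omega$, the quantifier $Q_A$ binds two variables and applies to five formulas: for a structure $\mathcal M$, formulas $\psi_0(x_0,x_1,\bar z),\psi_1(x_0,x_1,\bar z),\psi_2(x_0,x_1,\bar z),\psi_3(x_0,\bar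 z),\psi_4(x_0,\bar z)$ and $\bar c\in M^k$, $\mathcal M\models(Q_Ax_0x_1)(\psi_0,\ldots,\psi_4)[\bar c]$ iff $\Omega(\mathcal M_{\bar\psi})\setminus A$ is dense, where $\mathcal M_{\bar\psi}$ is the $\tau_d$-structure with universe $M$ interpreting $R_i$ ($i=0,1,2$) as $\{(a,b)\in M^2:\mathcal M\models\psi_i(a,b,\bar c)\}$ and $R_i$ ($i=3,4$) as $\{a\in M:\mathcal M\models\psi_i(a,\bar c)\}$. $L^d_A$ is the closure of first-order logic (all first-order formulas) under conjunction, disjunction, $\exists x$, $\forall x$, existential second-order quantification $\exists R$, and $Q_A$ (no negation beyond first-order formulas). *)

(* Defs.v *)
From mathcomp Require Import all_boot.
From mathcomp Require Import boolp classical_sets.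

Set Implicit Arguments.
Unset Strict Implicit.
Unset Printing Implicit Defensive.

Local Open Scope classical_set_scope.

(* Constants are function symbols of arity 0; the sets of symbols may have
   any cardinality. *)
Record signature := Signature {
  fun_sym : Type;
  rel_sym : Type;
  farity : fun_sym -> nat;
  rarity : rel_sym -> nat }.

(* Vocabularies are sets of symbols taken from a common ambient signature, so
   that they can be intersected. *)
Record vocabulary (Sg : signature) := Vocabulary {
  vfun : set (fun_sym Sg);
  vrel : set (rel_sym Sg) }.

Definition vocI (Sg : signature) (t1 t2 : vocabulary Sg) : vocabulary Sg :=
  Vocabulary (vfun t1 `&` vfun t2) (vrel t1 `&` vrel t2).

(* An [Sg]-structure also interprets the symbols outside a vocabulary [t]; this
   is harmless, since universes are nonempty (so every [t]-structure expands
   to an [Sg]-structure) and the truth of a formula only depends on the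
   interpretation of the symbols occurring in it. *)
Record structure (Sg : signature) := Structure {
  carrier :> Type;
  carrier_inhabited : inhabited carrier;
  fint : forall f : fun_sym Sg, ('I_(farity f) -> carrier) -> carrier;
  rint : forall r : rel_sym Sg, ('I_(rarity r) -> carrier) -> Prop }.

(* [add_rel Sg k] is Sg together with a new k-ary relation symbol [None]. *)
Definition add_rel (Sg : signature) (k : nat) : signature :=
  @Signature (fun_sym Sg) (option (rel_sym Sg)) (@farity Sg) (oapp (@rarity Sg) k).

Definition vadd_rel (Sg : signature) (k : nat) (t : vocabulary Sg) :
    vocabulary (add_rel Sg k) :=
  @Vocabulary (add_rel Sg k) (vfun t) (oapp (vrel t) True).

Definition expand (Sg : signature) (k : nat) (M : structure Sg)
    (R : ('I_k -> M) -> Prop) : structure (add_rel Sg k) :=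
  @Structure (add_rel Sg k) M (carrier_inhabited M) (@fint Sg M)
    (fun r => match r return ('I_(oapp (@rarity Sg) k r) -> M) -> Prop with
              | Some r' => @rint Sg M r'
              | None => R
              end).

(* Terms and formulas are well scoped: those indexed by n have their free
   variables among n variables, with de Bruijn indices in 'I_n. A binder adds
   index 0 and shifts the others by one. *)
Inductive term (Sg : signature) (n : nat) : Type :=
| Var of 'I_n
| App (f : fun_sym Sg) of 'I_(farity f) -> term Sg n.

Inductive fo (Sg : signature) (n : nat) : Type :=
| FOFalse
| FOEq of term Sg n & term Sg n
| FORel (r : rel_sym Sg) of 'I_(rarity r) -> term Sg n
| FONot of fo Sg n
| FOAnd of fo Sg n & fo Sg n
| FOOr of fo Sg n & fo Sg n
| FOEx of fo Sg n.+1
| FOAll of fo Sg n.+1.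

(* The syntax of L^d_A, which does not depend on A. In [LExRel phi] the bound
   relation is the symbol [None] of [add_rel Sg k]. In
   [LQ psi0 psi1 psi2 psi3 psi4] the bound x_0 is the variable 0 of each
   psi_i, and the bound x_1 is the variable 1 of psi0, psi1 and psi2. *)
Inductive ld (Sg : signature) (n : nat) : Type :=
| LFO of fo Sg n
| LAnd of ld Sg n & ld Sg n
| LOr of ld Sg n & ld Sg n
| LEx of ld Sg n.+1
| LAll of ld Sg n.+1
| LExRel (k : nat) of ld (add_rel Sg k) n
| LQ of ld Sg n.+2 & ld Sg n.+2 & ld Sg n.+2 & ld Sg n.+1 & ld Sg n.+1.

Arguments FOFalse {Sg n}.
Arguments Var {Sg n}.

Fixpoint term_in (Sg : signature) (n : nat) (t : vocabulary Sg) (u : term Sg n) :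
    Prop :=
  match u with
  | Var _ => True
  | App f a => vfun t f /\ forall i, term_in t (a i)
  end.

Fixpoint fo_in (Sg : signature) (n : nat) (t : vocabulary Sg) (phi : fo Sg n) :
    Prop :=
  match phi with
  | FOFalse => True
  | FOEq u v => term_in t u /\ term_in t v
  | FORel r a => vrel t r /\ forall i, term_in t (a i)
  | FONot p => fo_in t p
  | FOAnd p q | FOOr p q => fo_in t p /\ fo_in t q
  | FOEx p | FOAll p => fo_in t p
  end.

Fixpoint ld_in (Sg : signature) (n : nat) (t : vocabulary Sg) (phi : ld Sg n) :
    Prop :=
  match phi with
  | LFO p => fo_in t p
  | LAnd p q | LOr p q => ld_in t p /\ ld_in t q
  | LEx p | LAll p => ld_in t p
  | LExRel k p => ld_in (vadd_rel k t) p
  | LQ p0 p1 p2 p3 p4 =>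
      [/\ ld_in t p0, ld_in t p1, ld_in t p2, ld_in t p3 & ld_in t p4]
  end.

Definition vcons (T : Type) (n : nat) (a : T) (v : 'I_n -> T) : 'I_n.+1 -> T :=
  fun i => oapp v a (unlift ord0 i).

Fixpoint eval (Sg : signature) (M : structure Sg) (n : nat) (v : 'I_n -> M)
    (u : term Sg n) : M :=
  match u with
  | Var i => v i
  | App f a => fint (fun i => eval v (a i))
  end.

Fixpoint fo_sat (Sg : signature) (M : structure Sg) (n : nat) (v : 'I_n -> M)
    (phi : fo Sg n) : Prop :=
  match phi with
  | FOFalse => False
  | FOEq s u => eval v s = eval v u
  | FORel r a => rint (fun i => eval v (a i))
  | FONot p => ~ fo_sat v p
  | FOAnd p q => fo_sat v p /\ fo_sat v q
  | FOOr p q => fo_sat v p \/ fo_sat v q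
  | FOEx p => exists a : M, fo_sat (vcons a v) p
  | FOAll p => forall a : M, fo_sat (vcons a v) p
  end.

Inductive tau_d_rel := R0 | R1 | R2 | R3 | R4.

Definition tau_d : signature :=
  @Signature void tau_d_rel (fun _ => 0)
    (fun r => match r with R0 | R1 | R2 => 2 | R3 | R4 => 1 end).

Definition tau_d_structure (M : Type) (M0 : inhabited M)
    (P0 P1 P2 : M -> M -> Prop) (P3 P4 : M -> Prop) : structure tau_d :=
  @Structure tau_d M M0 (fun f : void => match f with end)
    (fun r => match r return ('I_(@rarity tau_d r) -> M) -> Prop with
              | R0 => fun a => P0 (a ord0) (a ord_max)
              | R1 => fun a => P1 (a ord0) (a ord_max)
              | R2 => fun a => P2 (a ord0) (a ord_max)
              | R3 => fun a => P3 (a ord0)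
              | R4 => fun a => P4 (a ord0)
              end).

Fixpoint FOExn (Sg : signature) (n m : nat) : fo Sg (m + n) -> fo Sg n :=
  match m return fo Sg (m + n) -> fo Sg n with
  | 0 => id
  | m'.+1 => fun phi => FOExn (FOEx phi)
  end.

Definition FOAndn (Sg : signature) (n : nat) (s : seq (fo Sg n)) : fo Sg n :=
  foldr (@FOAnd Sg n) (FONot FOFalse) s.

Definition atom_R0 (n : nat) (i j : 'I_n) : fo tau_d n :=
  @FORel tau_d n R0 (tnth [tuple Var i; Var j]).
Definition atom_R1 (n : nat) (i j : 'I_n) : fo tau_d n :=
  @FORel tau_d n R1 (tnth [tuple Var i; Var j]).
Definition atom_R2 (n : nat) (i j : 'I_n) : fo tau_d n :=
  @FORel tau_d n R2 (tnth [tuple Var i; Var j]).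
Definition atom_R3 (n : nat) (i : 'I_n) : fo tau_d n :=
  @FORel tau_d n R3 (fun=> Var i).
Definition atom_R4 (n : nat) (i : 'I_n) : fo tau_d n :=
  @FORel tau_d n R4 (fun=> Var i).

(* Finite binary sequences are [seq bool]. Under the n.+1 quantifiers
   y_0, ..., y_n (from the outside in), y_i has index n - i and x has index
   n.+1. *)
Definition psi (eta : seq bool) : fo tau_d 1 :=
  let n := size eta in
  let x : 'I_(n.+1 + 1) := inord n.+1 in
  let y i : 'I_(n.+1 + 1) := inord (n - i) in
  FOAnd (atom_R4 ord0)
    (@FOExn tau_d 1 n.+1
      (FOAnd (atom_R3 (y 0))
      (FOAnd (atom_R4 (y n))
      (FOAnd (FOAndn [seq if nth false eta i then atom_R1 (y i) (y i.+1)
                          else atom_R0 (y i) (y i.+1) | i <- iota 0 n])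
             (FOAndn [seq atom_R2 (y i) x | i <- iota 0 n.+1]))))).

Definition Omega_at (N : structure tau_d) (a : N) : set (seq bool) :=
  [set eta | fo_sat (fun _ : 'I_1 => a) (psi eta)].

(* [mkseq eta n] is the restriction of eta to n. *)
Definition Omega (N : structure tau_d) : set (nat -> bool) :=
  [set eta | exists a : N, forall n, Omega_at a (mkseq eta n)].

Definition cantor_dense (B : set (nat -> bool)) : Prop :=
  forall s : seq bool, exists2 eta, B eta & mkseq eta (size s) = s.

Fixpoint ld_sat (A : set (nat -> bool)) (Sg : signature) (n : nat)
    (phi : ld Sg n) : forall M : structure Sg, ('I_n -> M) -> Prop :=
  match phi with
  | LFO p => fun M v => fo_sat v p
  | LAnd p q => fun M v => ld_sat A p v /\ ld_sat A q v
  | LOr p q => fun M v => ld_sat A p v \/ ld_sat A q v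
  | LEx p => fun M v => exists a : M, ld_sat A p (vcons a v)
  | LAll p => fun M v => forall a : M, ld_sat A p (vcons a v)
  | LExRel k p => fun M v =>
      exists R : ('I_k -> M) -> Prop, @ld_sat A _ _ p (expand R) v
  | LQ p0 p1 p2 p3 p4 => fun M v =>
      cantor_dense
        (Omega (tau_d_structure (carrier_inhabited M)
                  (fun a b : M => ld_sat A p0 (vcons a (vcons b v)))
                  (fun a b : M => ld_sat A p1 (vcons a (vcons b v)))
                  (fun a b : M => ld_sat A p2 (vcons a (vcons b v)))
                  (fun a : M => ld_sat A p3 (vcons a v))
                  (fun a : M => ld_sat A p4 (vcons a v)))
         `\` A)
  end.

Definition no_vars (T : Type) : 'I_0 -> T :=
  fun i => match notF (ltn_ord i) with end.

(* Sentences are the formulas without free variables, those in [ld Sg 0]. *)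
Definition is_theory (Sg : signature) (t : vocabulary Sg) (T : set (ld Sg 0)) :
    Prop :=
  forall phi, T phi -> ld_in t phi.

Definition models (A : set (nat -> bool)) (Sg : signature) (M : structure Sg)
    (T : set (ld Sg 0)) : Prop :=
  forall phi, T phi -> ld_sat A phi (@no_vars M).

Definition consistent (A : set (nat -> bool)) (Sg : signature)
    (T : set (ld Sg 0)) : Prop :=
  exists M : structure Sg, models A M T.

Definition entails (A : set (nat -> bool)) (Sg : signature) (T : set (ld Sg 0))
    (phi : ld Sg 0) : Prop :=
  forall M : structure Sg, models A M T -> ld_sat A phi (@no_vars M).

Definition fo_complete (A : set (nat -> bool)) (Sg : signature)
    (t : vocabulary Sg) (T : set (ld Sg 0)) : Prop :=
  forall phi : fo Sg 0, fo_in t phi ->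
    entails A T (LFO phi) \/ entails A T (LFO (FONot phi)).

(* Main.v *)
Require Import Defs.
From mathcomp Require Import all_boot.
From mathcomp Require Import boolp classical_sets.
From mathcomp Require Import filter cardinality.

Local Open Scope classical_set_scope.

(* [L^d_A] is preserved by ultraproducts modulo countably incomplete ultrafilters:
   when Omega \ A is dense in almost every factor, any branch [eta] is realized up
   to longer and longer finite heights by elements of the factors, hence entirely by
   an element of the ultraproduct, and [eta] can be taken outside of [A] because
   the complement of [A] is dense. So the logic is compact, and it suffices
   to find a common model of finite fragments of [T1] and [T2]. Models [M1] and [M2]
   of these are elementarily equivalent for the finitely many common symbols, so the
   second player wins all finite Ehrenfeucht-Fraisse games on [M1], [M2], and
   survives infinitely many rounds on their ultrapowers. Playing along countable
   Skolem-type closures of the fragments (a downward Loewenheim-Skolem argument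
   valid for [L^d_A]) yields countable submodels of the two fragments which are
   isomorphic for the common symbols and can be merged into one structure. *)

Set Implicit Arguments.
Unset Strict Implicit.
Unset Printing Implicit Defensive.

(** * Satisfaction of the formulas [psi] *)

(** Assignments defined on all of [nat] spare the casts between ordinal types; only their values on
    an initial segment matter. *)
Definition ucons (T : Type) (a : T) (u : nat -> T) : nat -> T :=
  fun j => if j is j'.+1 then u j' else a.

Lemma vcons_ucons (T : Type) (n : nat) (a : T) (u : nat -> T) :
  vcons a (fun i : 'I_n => u i) = fun i : 'I_n.+1 => ucons a u i.
Proof.
apply: funext => i; rewrite /vcons.
by case: unliftP => [j ->|->].
Qed.

Lemma comp_vcons (S T : Type) (e : S -> T) (n : nat) (a : S) (v : 'I_n -> S) :
  e \o vcons a v = vcons (e a) (e \o v).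
Proof. by apply: funext => i; rewrite /vcons /=; case: unlift. Qed.

(** The innermost quantifier binds index 0, so a single sequence [w] carries the [m] witnesses first
    and the old assignment from index [m] on. *)
Lemma FOExnP (Sg : signature) (M : structure Sg) (n m : nat)
    (phi : fo Sg (m + n)) (v : 'I_n -> M) :
  fo_sat v (FOExn phi) <->
  exists w : nat -> M, (forall i : 'I_n, w (m + i)%N = v i) /\
    fo_sat (fun j : 'I_(m + n) => w j) phi.
Proof.
elim: m phi => [|m IH] phi /=.
  split=> [vphi|[w [wv]]]; last by rewrite (_ : (fun j => _) = v) //; apply: funext.
  (* A point of the nonempty universe fills the values of [w] past the free variables. *)
  case: (carrier_inhabited M) => d.
  exists (fun j => oapp v d (insub j)); split=> [i|]; first by rewrite valK.
  by rewrite (_ : (fun j => _) = v) //; apply: funext => i; rewrite valK.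
rewrite IH; split=> [[w [wv /= [a]]]|[w [wv wphi]]].
  by rewrite vcons_ucons => aphi; exists (ucons a w).
exists (fun j => w j.+1); split=> [i|]; first by rewrite -wv addSn.
exists (w 0); rewrite (vcons_ucons _ _ (fun j => w j.+1)); move: wphi.
by rewrite (_ : (fun j : 'I_(m.+1 + n) => w j) = (fun i => ucons (w 0) (fun j => w j.+1) i)) //;
  apply: funext => -[[|i] ?].
Qed.

Lemma FOAndnP (Sg : signature) (M : structure Sg) (n : nat) (T : eqType) (s : seq T)
    (F : T -> fo Sg n) (v : 'I_n -> M) :
  fo_sat v (FOAndn [seq F i | i <- s]) <-> forall i, i \in s -> fo_sat v (F i).
Proof.
elim: s => [|x s IH] /=; first by split=> [_ i|_ []]; rewrite ?in_nil.
rewrite IH; split=> [[Fx Fs] i|H]; first by rewrite inE => /predU1P[->|/Fs].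
by split=> [|i si]; apply: H; rewrite inE ?eqxx ?si ?orbT.
Qed.

Definition branch (M : Type) (P0 P1 P2 : M -> M -> Prop) (P3 P4 : M -> Prop)
    (a : M) (eta : seq bool) (y : nat -> M) : Prop :=
  [/\ P3 (y 0), P4 (y (size eta)),
      forall i, i < size eta -> if nth false eta i then P1 (y i) (y i.+1)
                                else P0 (y i) (y i.+1)
    & forall i, i <= size eta -> P2 (y i) a].

(** This removes the de Bruijn indices from [psi]: the path [y] is listed in its natural order,
    while [psi] stores it reversed. *)
Lemma Omega_atP (M : Type) (M0 : inhabited M) (P0 P1 P2 : M -> M -> Prop)
    (P3 P4 : M -> Prop) (a : M) (eta : seq bool) :
  @Omega_at (tau_d_structure M0 P0 P1 P2 P3 P4) a eta <->
  P4 a /\ exists y, branch P0 P1 P2 P3 P4 a eta y.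
Proof.
rewrite /Omega_at /= /psi; set n := size eta.
have lty i : n - i < n.+1 + 1 by rewrite addn1 ltnS (leq_trans (leq_subr _ _)).
have ltx : n.+1 < n.+1 + 1 by rewrite addn1.
split=> -[P4a].
  move=> /(@FOExnP tau_d (tau_d_structure M0 P0 P1 P2 P3 P4) 1 n.+1)[w [wa]] /=.
  rewrite !inordK // => -[P3y [P4y]].
  rewrite !(@FOAndnP tau_d (tau_d_structure M0 P0 P1 P2 P3 P4)) => -[P01 [P20 P2y]].
  have wx : w n.+1 = a by rewrite -[RHS](wa ord0) addn0.
  split=> //; exists (fun i => w (n - i)); split=> // i ltin.
    have := P01 i; rewrite mem_iota ltin => /(_ erefl).
    by case: nth => /=; rewrite !inordK.
  (* The conjunct for [y 0] stands apart because [iota 0 n.+1] has computed to a list with head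
     0. *)
  case: i ltin => [|i] lein; first by rewrite -wx.
  by have := P2y i.+1; rewrite mem_iota => /(_ lein) /=; rewrite !inordK // wx.
move=> [y [P3y P4y P01 P2y]]; split=> //.
apply/(@FOExnP tau_d (tau_d_structure M0 P0 P1 P2 P3 P4) 1 n.+1).
(* The point [y i] sits at index [n - i] and [a] at index [n.+1]. *)
pose w j := if j <= n then y (n - j) else a.
have wy i : i <= n -> w (n - i) = y i by move=> le; rewrite /w leq_subr subKn.
have wx : w n.+1 = a by rewrite /w ltnn.
exists w; split=> [i|]; first by rewrite /w -ltn_subRL subnn.
rewrite /= !inordK // !wy //.
rewrite !(@FOAndnP tau_d (tau_d_structure M0 P0 P1 P2 P3 P4)).
do 4?split => //; rewrite ?wx; try exact: P2y; move=> i; rewrite mem_iota.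
  move=> /= ltin; have := P01 _ ltin; have lein := ltnW ltin.
  by case: nth => /=; rewrite !inordK // !wy.
by case: i => // i lein; rewrite /= !inordK // wx wy //; apply: P2y.
Qed.

(** * Ultraproducts *)

(** Coordinates without a witness receive an arbitrary default; they form a set outside the scope of
    the conclusion. *)
Lemma filter_choice (I : Type) (U : set_system I) (T : I -> Type)
    (P : forall i, T i -> Prop) : Filter U -> (forall i, inhabited (T i)) ->
  U [set i | exists x, P i x] -> exists f : forall i, T i, U [set i | P i (f i)].
Proof.
move=> FU T0 UP.
have /all_sig[f fP] i : {x : T i | (exists x, P i x) -> P i x}.
  apply: cid; have [[x Px]|nP] := pselect (exists x, P i x); first by exists x.
  by case: (T0 i) => x; exists x.
by exists f; apply: filterS UP => i; apply: fP.
Qed.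

Section Ultraproduct.
Context (I : Type) (U : set_system I) {FU : UltraFilter U}.

Lemma ultra_meet (P Q : set I) : U P -> U Q -> exists2 i, P i & Q i.
Proof.
move=> UP UQ; have UPQ : U (P `&` Q) by apply: filterI.
by have [i []] := filter_ex UPQ; exists i.
Qed.

Lemma ultraN (P : set I) : U [set i | ~ P i] <-> ~ U P.
Proof.
split=> [UN UP|]; last by case: (in_ultra_setVsetC P FU).
by have [] := ultra_meet UN UP.
Qed.

Lemma ultra_or (P Q : set I) : U [set i | P i \/ Q i] -> U P \/ U Q.
Proof.
move=> UPQ; apply: contrapT => /not_orP[/ultraN NP /ultraN NQ].
have NPQ : U ([set i | ~ P i] `&` [set i | ~ Q i]) by apply: filterI.
by have [i []] := ultra_meet UPQ NPQ => // ? [].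
Qed.

Definition ae_eq (T : I -> Type) (f g : forall i, T i) := U [set i | f i = g i].

(* Elements of the ultraproduct are the classes of [ae_eq], as sets. *)
Definition uprod (T : I -> Type) :=
  {P : set (forall i, T i) | exists f, P = ae_eq f}.

Definition ucls (T : I -> Type) (f : forall i, T i) : uprod T :=
  exist _ (ae_eq f) (ex_intro _ f erefl).

Definition urepr (T : I -> Type) (x : uprod T) : forall i, T i :=
  sval (cid (svalP x)).

Lemma ae_eq_trans (T : I -> Type) (f g h : forall i, T i) :
  ae_eq f g -> ae_eq f h -> ae_eq g h.
Proof. by apply: filterS2 => i /= -> ->. Qed.

Lemma ae_eq_sym (T : I -> Type) (f g : forall i, T i) : ae_eq f g -> ae_eq g f.
Proof. by apply: filterS => i /= ->. Qed.

Lemma ae_eq_refl (T : I -> Type) (f : forall i, T i) : ae_eq f f.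
Proof. exact: filterE. Qed.

Lemma ucls_eq (T : I -> Type) (f g : forall i, T i) :
  ucls f = ucls g <-> ae_eq f g.
Proof.
split=> [/(congr1 sval) /= fg|fg].
  by rewrite -[ae_eq f g]/(ae_eq f g) fg; apply: ae_eq_refl.
apply: eq_exist; apply/seteqP; split=> h; apply: ae_eq_trans => //.
exact: ae_eq_sym.
Qed.

Lemma ureprK (T : I -> Type) : cancel (@urepr T) (@ucls T).
Proof. by move=> [P fP]; apply: eq_exist; rewrite /urepr; case: cid. Qed.

Lemma urepr_ucls (T : I -> Type) (f : forall i, T i) :
  U [set i | urepr (ucls f) i = f i].
Proof. by apply/ucls_eq; rewrite ureprK. Qed.

Lemma uprod_inhabited (T : I -> Type) :
  (forall i, inhabited (T i)) -> inhabited (uprod T).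
Proof.
move=> T0; have /all_sig[f _] i : {x : T i | True}.
  by apply: cid; case: (T0 i) => x; exists x.
by constructor; apply: ucls.
Qed.

(** Symbols are interpreted on the chosen representatives [urepr]; [eval_ucls] and [rint_ucls] show
    that any other representatives give the same result. *)
Definition ultraproduct (Sg : signature) (M : I -> structure Sg) : structure Sg :=
  @Structure Sg (uprod (fun i => M i : Type))
    (uprod_inhabited (fun i => carrier_inhabited (M i)))
    (fun f a => ucls (fun i => fint (fun j => urepr (a j) i)))
    (fun r a => U [set i | rint (fun j => urepr (a j) i)]).

Section Los.
Variables (Sg : signature) (M : I -> structure Sg).
Implicit Types f : forall i, M i.

Lemma urepr_ucls_fin (m : nat) (a : 'I_m -> forall i, M i) :
  U [set i | (fun j => urepr (ucls (a j)) i) = (fun j => a j i)].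
Proof.
have /filter_forall : forall j, U [set i | urepr (ucls (a j)) i = a j i].
  by move=> j; apply: urepr_ucls.
by apply: filterS => i aE; apply: funext.
Qed.

Lemma eval_ucls (n : nat) (v : 'I_n -> forall i, M i) (t : term Sg n) :
  @eval Sg (ultraproduct M) n (fun j => ucls (v j)) t =
  ucls (fun i => eval (fun j => v j i) t).
Proof.
elim: t => //= f a IH; apply/ucls_eq.
apply: filterS (urepr_ucls_fin (fun j i => eval (fun j => v j i) (a j))) => i /= <-.
by congr fint; apply: funext => j; rewrite IH.
Qed.

Lemma rint_ucls (r : rel_sym Sg) (a : 'I_(rarity r) -> forall i, M i) :
  @rint Sg (ultraproduct M) r (fun j => ucls (a j)) <-> U [set i | rint (fun j => a j i)].
Proof.
split=> /=; first by apply: filterS2 (urepr_ucls_fin a) => i /= <-.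
by apply: filterS2 (urepr_ucls_fin a) => i /= ->.
Qed.

Lemma vcons_at (n : nat) (f : forall i, M i) (v : 'I_n -> forall i, M i) i :
  (fun j => vcons f v j i) = vcons (f i) (fun j => v j i).
Proof. exact: (comp_vcons (fun g : forall i, M i => g i)). Qed.

Lemma ucls_vcons (n : nat) (f : forall i, M i) (v : 'I_n -> forall i, M i) :
  vcons (ucls f) (fun j => ucls (v j)) = (fun j => ucls (vcons f v j)).
Proof. by rewrite -[RHS]/(@ucls _ \o vcons f v) comp_vcons. Qed.

(** The theorem of Los: maximality of [U] handles negation and disjunction, and a choice of
    witnesses in the factors handles quantifiers. *)
Lemma los (n : nat) (phi : fo Sg n) (v : 'I_n -> forall i, M i) :
  @fo_sat Sg (ultraproduct M) n (fun j => ucls (v j)) phi <->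
  U [set i | fo_sat (fun j => v j i) phi].
Proof.
elim: phi v => {n} [n|n t1 t2|n r a|n p IH|n p IHp q IHq|n p IHp q IHq|n p IH|n p IH] v /=.
- by split=> // /filter_ex[].
- by rewrite !eval_ucls ucls_eq.
- apply: iff_trans (rint_ucls (fun j i => eval (fun j => v j i) (a j))) => /=.
  by under eq_fun do under eq_fun do rewrite eval_ucls.
- by rewrite IH ultraN.
- rewrite IHp IHq; split=> [[Up Uq]|Upq]; first exact: filterI.
  by split; apply: filterS Upq => i [].
- rewrite IHp IHq; split=> [[]|]; last exact: ultra_or.
    by apply: filterS; left.
  by apply: filterS; right.
- split=> [[x]|Up].
    rewrite -(ureprK x) ucls_vcons IH; apply: filterS => i xp.
    by exists (urepr x i); rewrite -(vcons_at (urepr x) v i).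
  have [f fP] := filter_choice _ (fun i => carrier_inhabited (M i)) Up.
  exists (ucls f); rewrite ucls_vcons IH.
  by apply: filterS fP => i /=; rewrite -(vcons_at f v i).
- split=> [Ap|Up x].
    (* If almost every factor had a counterexample, a choice of them would define a counterexample
       in the ultraproduct. *)
    apply: contrapT => /ultraN N.
    have := @filter_choice I U M (fun i x => ~ fo_sat (vcons x (fun j => v j i)) p) _
      (fun i => carrier_inhabited (M i)).
    case=> [|f /ultraN]; first by apply: filterS N => i /existsNP.
    apply; have := Ap (ucls f); rewrite ucls_vcons IH.
    by apply: filterS => i /=; rewrite (vcons_at f v i).
  rewrite -(ureprK x) ucls_vcons IH.
  by apply: filterS Up => i /= /(_ (urepr x i)); rewrite -(vcons_at (urepr x) v i).
Qed.

End Los.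

(** An ultraproduct of expansions and an expansion of the ultraproduct have the same relations only
    after a case analysis on the symbol, hence the appeal to dependent extensionality. *)
Lemma ld_sat_eq_rint (A : set (nat -> bool)) (Sg : signature) (M : Type)
    (M0 M0' : inhabited M) (F : forall f : fun_sym Sg, ('I_(farity f) -> M) -> M)
    (R R' : forall r : rel_sym Sg, ('I_(rarity r) -> M) -> Prop)
    (n : nat) (phi : ld Sg n) (v : 'I_n -> M) :
  (forall r, R r = R' r) -> @ld_sat A Sg n phi (Structure M0 F R) v ->
  @ld_sat A Sg n phi (Structure M0' F R') v.
Proof.
move=> RE; have {RE} <- : R = R' by apply: functional_extensionality_dep.
by rewrite (Prop_irrelevance M0 M0').
Qed.

(** Countable incompleteness of [U] is expressed by a function [kappa] that tends to infinity along
    [U]. *)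
Variables (A : set (nat -> bool)) (kappa : I -> nat).
Hypotheses (A_codense : cantor_dense (~` A))
  (kappa_unbounded : forall n, U [set i | n <= kappa i]).

(* A branch of length [kappa i] in each factor suffices for an infinite one in the
   ultraproduct, so the branch can be chosen outside of [A]. *)
Lemma ld_ultraproduct (Sg : signature) (n : nat) (phi : ld Sg n)
    (M : I -> structure Sg) (v : 'I_n -> forall i, M i) :
  U [set i | ld_sat A phi (fun j => v j i)] ->
  @ld_sat A Sg n phi (ultraproduct M) (fun j => ucls (v j)).
Proof.
elim: phi M v => {Sg n}
  [Sg n p|Sg n p IHp q IHq|Sg n p IHp q IHq|Sg n p IH|Sg n p IH|Sg n k p IH
  |Sg n p0 IH0 p1 IH1 p2 IH2 p3 IH3 p4 IH4] M v /=.
- by rewrite los.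
- by move=> U_; split; [apply: IHp|apply: IHq]; apply: filterS U_ => i [].
- by case/ultra_or => [/IHp|/IHq]; [left|right].
- move=> Up; have [f fP] := filter_choice _ (fun i => carrier_inhabited (M i)) Up.
  exists (ucls f); rewrite ucls_vcons; apply: IH.
  by apply: filterS fP => i /=; rewrite -(vcons_at f v i).
- move=> Up x; rewrite -(ureprK x) ucls_vcons; apply: IH.
  by apply: filterS Up => i /= /(_ (urepr x i)); rewrite -(vcons_at (urepr x) v i).
- move=> Up.
  have [] := @filter_choice I U (fun i => ('I_k -> M i) -> Prop)
    (fun i R => @ld_sat A _ _ p (expand R) (fun j => v j i)) _ _ Up.
    by move=> i; constructor=> _; exact: True.
  (* The witness is the ultraproduct of relations chosen in the factors. *)
  move=> R RP; exists (fun a => U [set i | R i (fun j => urepr (a j) i)]).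
  by apply: ld_sat_eq_rint (IH (fun i => expand (R i)) v RP) => -[].
- have K1 (q : ld Sg n.+1) : (forall M v, U [set i | ld_sat A q (fun j => v j i)] ->
      @ld_sat A Sg _ q (ultraproduct M) (fun j => ucls (v j))) ->
      forall f : forall i, M i, U [set i | ld_sat A q (vcons (f i) (fun j => v j i))] ->
      @ld_sat A Sg _ q (ultraproduct M) (vcons (ucls f) (fun j => ucls (v j))).
    move=> IH f Uq; rewrite ucls_vcons; apply: IH.
    by apply: filterS Uq => i; rewrite /= -(vcons_at f v i).
  have K2 (q : ld Sg n.+2) : (forall M v, U [set i | ld_sat A q (fun j => v j i)] ->
      @ld_sat A Sg _ q (ultraproduct M) (fun j => ucls (v j))) ->
      forall f g : forall i, M i,
      U [set i | ld_sat A q (vcons (f i) (vcons (g i) (fun j => v j i)))] ->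
      @ld_sat A Sg _ q (ultraproduct M)
        (vcons (ucls f) (vcons (ucls g) (fun j => ucls (v j)))).
    move=> IH f g Uq; rewrite !ucls_vcons; apply: IH; apply: filterS Uq => i.
    by rewrite /= -(vcons_at g v i) -(vcons_at f (vcons g v) i).
  (* The branch [eta] comes from the density of the complement of [A] alone, before any factor is
     consulted. *)
  move=> Q s; have [eta nAeta etas] := A_codense s; exists eta => //; split=> //.
  have [] := @filter_choice I U M (fun i x => forall m, m <= kappa i ->
    @Omega_at (tau_d_structure (carrier_inhabited (M i))
      (fun a b => ld_sat A p0 (vcons a (vcons b (fun j => v j i))))
      (fun a b => ld_sat A p1 (vcons a (vcons b (fun j => v j i))))
      (fun a b => ld_sat A p2 (vcons a (vcons b (fun j => v j i))))
      (fun a => ld_sat A p3 (vcons a (fun j => v j i)))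
      (fun a => ld_sat A p4 (vcons a (fun j => v j i)))) x (mkseq eta m)) _
    (fun i => carrier_inhabited (M i)).
    (* Density in the factor [i], applied to the restriction of [eta] to [kappa i], gives a realized
       branch [eta'] that agrees with [eta] up to that height. *)
    apply: filterS Q => i /= /(_ (mkseq eta (kappa i)))[eta' [[a aeta'] _]].
    rewrite size_mkseq => etaE; exists a => m lem.
    suff -> : mkseq eta m = mkseq eta' m by apply: aeta'.
    have takeE (h : nat -> bool) : mkseq h m = take m (mkseq h (kappa i)).
      by rewrite -map_take take_iota (minn_idPl lem).
    by rewrite !takeE etaE.
  move=> a aP; exists (ucls a) => m; apply/Omega_atP.
  have {}aP : U [set i | ld_sat A p4 (vcons (a i) (fun j => v j i)) /\ exists y, branch
      (fun a b => ld_sat A p0 (vcons a (vcons b (fun j => v j i))))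
      (fun a b => ld_sat A p1 (vcons a (vcons b (fun j => v j i))))
      (fun a b => ld_sat A p2 (vcons a (vcons b (fun j => v j i))))
      (fun a => ld_sat A p3 (vcons a (fun j => v j i)))
      (fun a => ld_sat A p4 (vcons a (fun j => v j i))) (a i) (mkseq eta m) y].
    apply: filterS2 (kappa_unbounded m) aP => i lem /(_ m lem).
    by move/Omega_atP.
  have [] := @filter_choice I U (fun i => nat -> M i) (fun i y => branch
      (fun a b => ld_sat A p0 (vcons a (vcons b (fun j => v j i))))
      (fun a b => ld_sat A p1 (vcons a (vcons b (fun j => v j i))))
      (fun a b => ld_sat A p2 (vcons a (vcons b (fun j => v j i))))
      (fun a => ld_sat A p3 (vcons a (fun j => v j i)))
      (fun a => ld_sat A p4 (vcons a (fun j => v j i))) (a i) (mkseq eta m) y) _.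
  - by move=> i; case: (carrier_inhabited (M i)) => x; constructor.
  - by apply: filterS aP => i [].
  (* The clauses of [branch] are positive in the five formulas, so induction hypotheses in one
     direction suffice to lift the chosen paths. *)
  move=> y yP; split; first by apply: K1 => //; apply: filterS aP => i [].
  exists (fun j => ucls (fun i => y i j)); split.
  - by apply: K1 => //; apply: filterS yP => i [].
  - by apply: K1 => //; apply: filterS yP => i [].
  - move=> j ltj; case E: nth; apply: K2 => //; apply: filterS yP => i [_ _ /(_ j ltj)];
      by rewrite E.
  by move=> j lej; apply: K2 => //; apply: filterS yP => i [_ _ _ /(_ j lej)].
Qed.
End Ultraproduct.

(** * Downward Loewenheim-Skolem closures *)

Definition embedding (Sg : signature) (t : vocabulary Sg) (N M : structure Sg)
    (e : N -> M) : Prop :=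
  [/\ injective e,
      forall f, vfun t f -> forall a, e (@fint Sg N f a) = fint (e \o a)
    & forall r, vrel t r -> forall a, @rint Sg N r a <-> rint (e \o a)].

(* [C s] lists countably many elements to be added to any set containing [s]. *)
Definition closed_under (M : Type) (C : seq M -> nat -> M) (N : Type) (e : N -> M) :=
  forall (s : seq N) (j : nat), exists y, e y = C (map e s) j.

Section Closures.
Variable M : Type.

Definition closure2 (C1 C2 : seq M -> nat -> M) : seq M -> nat -> M :=
  fun s j => (if odd j then C1 else C2) s j./2.

Lemma closed_under2 (C1 C2 : seq M -> nat -> M) (N : Type) (e : N -> M) :
  closed_under (closure2 C1 C2) e -> closed_under C1 e /\ closed_under C2 e.
Proof.
move=> cl; split=> s j.
  have [y ey] := cl s j.*2.+1; exists y; rewrite ey.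
  by rewrite /closure2 /= odd_double /= uphalf_double.
have [y ey] := cl s j.*2; exists y; rewrite ey.
by rewrite /closure2 odd_double doubleK.
Qed.

(** Closure functions that depend on an assignment become uniform: the first [n] entries of the list
    encode the assignment, and [d] only pads lists that are too short. *)
Definition closure_param (d : M) (n : nat) (C : ('I_n -> M) -> seq M -> nat -> M) :
    seq M -> nat -> M :=
  fun s => C (fun i => nth d s i) (drop n s).

Lemma closed_under_param (d : M) (n : nat) (C : ('I_n -> M) -> seq M -> nat -> M)
    (N : Type) (e : N -> M) (v : 'I_n -> N) :
  closed_under (closure_param d C) e -> closed_under (C (e \o v)) e.
Proof.
move=> cl s j; have [y ey] := cl (codom v ++ s) j; exists y; rewrite ey.
rewrite /closure_param map_cat drop_size_cat; last by rewrite size_map size_codom card_ord.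
congr (C _ _ _); apply: funext => i; rewrite nth_cat size_map size_codom card_ord ltn_ord.
by rewrite -map_comp (nth_map i) ?size_enum_ord // nth_ord_enum.
Qed.
End Closures.

Lemma eval_embedding (Sg : signature) (t : vocabulary Sg) (N M : structure Sg)
    (e : N -> M) (n : nat) (v : 'I_n -> N) (u : term Sg n) :
  embedding t e -> term_in t u -> e (eval v u) = eval (e \o v) u.
Proof.
case=> _ ef _; elim: u => //= f a IH [tf ta]; rewrite ef //.
by congr fint; apply: funext => i; rewrite /= IH.
Qed.

(** This is the Tarski-Vaught argument: [C] collects Skolem witnesses for all quantifiers of [phi],
    and is fixed before the vocabulary and the substructure are known. *)
Lemma fo_closure (Sg : signature) (n : nat) (phi : fo Sg n) (M : structure Sg) :
  exists C : seq M -> nat -> M, forall (t : vocabulary Sg) (N : structure Sg) (e : N -> M),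
    embedding t e -> closed_under C e -> fo_in t phi ->
    forall v : 'I_n -> N, fo_sat v phi <-> fo_sat (e \o v) phi.
Proof.
case: (carrier_inhabited M) => d.
elim: phi => {n} [n|n t1 t2|n r a|n p [C IH]|n p [C1 IH1] q [C2 IH2]
  |n p [C1 IH1] q [C2 IH2]|n p [C IH]|n p [C IH]].
- by exists (fun _ _ => d).
- exists (fun _ _ => d) => t N e et _ [u1 u2] v /=.
  rewrite -!(eval_embedding _ et) //; split=> [->//|].
  by case: et => ei _ _; apply: ei.
- exists (fun _ _ => d) => t N e et _ [tr ta] v /=.
  have [_ _ er] := et; rewrite er //.
  suff -> : e \o (fun i => eval v (a i)) = (fun i => eval (e \o v) (a i)) by [].
  by apply: funext => i; rewrite -(eval_embedding _ et).
- by exists C => t N e et cl tp v /=; rewrite (IH t N e).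
- exists (closure2 C1 C2) => t N e et /closed_under2[cl1 cl2] [tp tq] v /=.
  by rewrite (IH1 t N e) // (IH2 t N e).
- exists (closure2 C1 C2) => t N e et /closed_under2[cl1 cl2] [tp tq] v /=.
  by rewrite (IH1 t N e) // (IH2 t N e).
- have /choice[W WP] : forall v : 'I_n -> M, exists a, fo_sat v (FOEx p) -> fo_sat (vcons a v) p.
    move=> v; have [[a pa]|np] := pselect (fo_sat v (FOEx p)); last by exists d.
    by exists a.
  exists (closure2 C (closure_param d (fun v _ _ => W v))).
  move=> t N e et /closed_under2[cl clW] tp v /=; split=> [[a]|/WP Wp].
    by rewrite (IH t N e) // comp_vcons => ap; exists (e a).
  have [y ey] := closed_under_param v clW [::] 0.
  by exists y; rewrite (IH t N e) // comp_vcons ey.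
(* Here [W v] is a counterexample whenever one exists, so truth at [W v] forces the universal
   statement. *)
- have /choice[W WP] : forall v : 'I_n -> M, exists a, fo_sat (vcons a v) p -> fo_sat v (FOAll p).
    move=> v; have [Ap|/existsNP[a np]] := pselect (fo_sat v (FOAll p)); first by exists d.
    by exists a.
  exists (closure2 C (closure_param d (fun v _ _ => W v))).
  move=> t N e et /closed_under2[cl clW] tp v /=; split=> [Np|Mp a]; last first.
    by rewrite (IH t N e) // comp_vcons.
  have [y ey] := closed_under_param v clW [::] 0.
  by apply: WP; have := Np y; rewrite (IH t N e) // comp_vcons ey.
Qed.

Lemma embedding_expand (Sg : signature) (t : vocabulary Sg) (N M : structure Sg)
    (e : N -> M) (k : nat) (R : ('I_k -> M) -> Prop) :
  embedding t e ->
  @embedding _ (vadd_rel k t) (expand (fun a => R (e \o a))) (expand R) e.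
Proof. by case=> ei ef er; split=> // -[]. Qed.

(** * Downward transfer of truth for [L^d_A] *)

Section LdClosure.
Variable A : set (nat -> bool).

(** Truth only has to descend: existential witnesses are added, bound relations are restricted, and
    universal quantifiers pass to subsets. For [LQ] there are countably many strings, each asking
    for one element and countably many finite paths. *)
Lemma ld_closure (Sg : signature) (n : nat) (phi : ld Sg n) (M : structure Sg) :
  exists C : seq M -> nat -> M, forall (t : vocabulary Sg) (N : structure Sg) (e : N -> M),
    embedding t e -> closed_under C e -> ld_in t phi ->
    forall v : 'I_n -> N, ld_sat A phi (e \o v) -> ld_sat A phi v.
Proof.
elim: phi M => {Sg n}
  [Sg n p|Sg n p IHp q IHq|Sg n p IHp q IHq|Sg n p IH|Sg n p IH|Sg n k p IH
  |Sg n p0 IH0 p1 IH1 p2 IH2 p3 IH3 p4 IH4] M; case: (carrier_inhabited M) => d.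
- have [C CP] := fo_closure p M.
  by exists C => t N e et cl tp v; apply: (iffRL (CP t N e et cl tp v)).
- have [[C1 IH1] [C2 IH2]] := (IHp M, IHq M).
  exists (closure2 C1 C2) => t N e et /closed_under2[cl1 cl2] [tp tq] v /= [Mp Mq].
  by split; [apply: (IH1 t N e)|apply: (IH2 t N e)].
- have [[C1 IH1] [C2 IH2]] := (IHp M, IHq M).
  exists (closure2 C1 C2) => t N e et /closed_under2[cl1 cl2] [tp tq] v /= [Mp|Mq].
    by left; apply: (IH1 t N e).
  by right; apply: (IH2 t N e).
- have {IH}[C IH] := IH M.
  have /choice[W WP] : forall v : 'I_n -> M, exists a, ld_sat A (LEx p) v -> ld_sat A p (vcons a v).
    move=> v; have [[a pa]|np] := pselect (ld_sat A (LEx p) v); last by exists d.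
    by exists a.
  exists (closure2 C (closure_param d (fun v _ _ => W v))).
  move=> t N e et /closed_under2[cl clW] tp v /WP Wp.
  have [y ey] := closed_under_param v clW [::] 0.
  by exists y; apply: (IH t N e) => //; rewrite comp_vcons ey.
- have {IH}[C IH] := IH M.
  exists C => t N e et cl tp v /= Mp a; apply: (IH t N e) => //.
  by rewrite comp_vcons.
- have /choice[R RP] : forall v : 'I_n -> M, exists R : ('I_k -> M) -> Prop,
      ld_sat A (LExRel p) v -> @ld_sat A _ _ p (expand R) v.
    move=> v; have [[R Rp]|np] := pselect (ld_sat A (LExRel p) v); first by exists R.
    by exists (fun=> True).
  (* The expansion depends on the relation chosen for [v], so each assignment has its own closure
     function; [closure_param] then joins them. *)
  have {IH}/choice[C CP] : forall v : 'I_n -> M, exists C : seq M -> nat -> M,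
      forall t (N : structure (add_rel Sg k)) (e : N -> M),
      @embedding _ t N (expand (R v)) e -> closed_under C e ->
      ld_in t p -> forall w : 'I_n -> N,
      @ld_sat A _ _ p (expand (R v)) (e \o w) -> ld_sat A p w.
    by move=> v; apply: (IH (expand (R v))).
  exists (closure_param d C) => t N e et cl tp v /RP Mp.
  exists (fun a => R (e \o v) (e \o a)).
  have K := CP (e \o v) _ (expand (fun a => R (e \o v) (e \o a))) e
    (embedding_expand (R (e \o v)) et).
  exact: K (closed_under_param v cl) tp v Mp.
- have [[[C0 {}IH0] [C1 {}IH1]] [[C2 {}IH2] [[C3 {}IH3] [C4 {}IH4]]]] :=
    ((IH0 M, IH1 M), (IH2 M, (IH3 M, IH4 M))).
  pose B (v : 'I_n -> M) a eta y := branch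
    (fun a b => ld_sat A p0 (vcons a (vcons b v)))
    (fun a b => ld_sat A p1 (vcons a (vcons b v)))
    (fun a b => ld_sat A p2 (vcons a (vcons b v)))
    (fun a => ld_sat A p3 (vcons a v)) (fun a => ld_sat A p4 (vcons a v)) a eta y.
  (* For an assignment and a string, [W] returns a branch outside of [A] through the string, an
     element realizing it, and for each [m] a path for its restriction to [m]. The branch is not an
     element of [M], so it serves the substructure unchanged. *)
  have /choice[W WP] : forall vs : ('I_n -> M) * seq bool,
      exists w : (nat -> bool) * M * (nat -> nat -> M), ld_sat A (LQ p0 p1 p2 p3 p4) vs.1 ->
      [/\ ~ A w.1.1, mkseq w.1.1 (size vs.2) = vs.2, ld_sat A p4 (vcons w.1.2 vs.1) &
        forall m, B vs.1 w.1.2 (mkseq w.1.1 m) (w.2 m)].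
    move=> [v s] /=; have [Q|nQ] := pselect (ld_sat A (LQ p0 p1 p2 p3 p4) v); last first.
      by exists (fun=> false, d, fun _ _ => d).
    have [eta [[a /= etaP] nA] etas] := Q s.
    have /choice[y yP] m : exists y, B v a (mkseq eta m) y.
      by have /Omega_atP[_ []] := etaP m => y; exists y.
    exists (eta, a, y) => _; split=> //=.
    by have /Omega_atP[] := etaP 0.
  (* A number coding [(s, m, i)] asks for the realizing element when [m] is 0, and for the [i]-th
     point of the path of length [m'] when [m] is [m'.+1]. *)
  exists (closure2 (closure2 C0 C1) (closure2 C2 (closure2 C3 (closure2 C4
    (closure_param d (fun v _ j => if unpickle j is Some (s, m, i) then
       if m is m'.+1 then (W (v, s)).2 m' i else (W (v, s)).1.2 else d)))))).
  move=> t N e et /closed_under2[/closed_under2[cl0 cl1]].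
  move=> /closed_under2[cl2 /closed_under2[cl3 /closed_under2[cl4 cl]]].
  move=> [t0 t1 t2 t3 t4] v Q s.
  have [] := WP (e \o v, s) Q => /=; set w := W _ => nA ws w4 wB.
  have {}cl := closed_under_param v cl [::].
  exists w.1.1 => //; split=> //.
  have [a ea] := cl (pickle (s, 0, 0)); rewrite pickleK -/w in ea.
  have K1 q C : (forall t (N : structure Sg) (e : N -> M),
      embedding t e -> closed_under C e -> ld_in t q ->
      forall v : 'I_n.+1 -> N, ld_sat A q (e \o v) -> ld_sat A q v) ->
      closed_under C e -> ld_in t q ->
      forall b, ld_sat A q (vcons (e b) (e \o v)) -> ld_sat A q (vcons b v).
    move=> IH clC tq b; rewrite -comp_vcons; exact: (IH t N e).
  have K2 q C : (forall t (N : structure Sg) (e : N -> M),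
      embedding t e -> closed_under C e -> ld_in t q ->
      forall v : 'I_n.+2 -> N, ld_sat A q (e \o v) -> ld_sat A q v) ->
      closed_under C e -> ld_in t q ->
      forall b c, ld_sat A q (vcons (e b) (vcons (e c) (e \o v))) ->
      ld_sat A q (vcons b (vcons c v)).
    move=> IH clC tq b c; rewrite -!comp_vcons; exact: (IH t N e).
  exists a => m; apply/Omega_atP; split; first by apply: (K1 _ C4) => //; rewrite ea.
  have /choice[y ey] : forall i, exists y, e y = w.2 m i.
    by move=> i; have [y] := cl (pickle (s, m.+1, i)); rewrite pickleK; exists y.
  have [B3 B4 B01 B2] := wB m.
  exists y; split.
  - by apply: (K1 _ C3) => //; rewrite ey.
  - by apply: (K1 _ C4) => //; rewrite ey.
  - move=> i lti; have := B01 i lti; case E: nth => B_.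
      by apply: (K2 _ C1) => //; rewrite !ey.
    by apply: (K2 _ C0) => //; rewrite !ey.
  - by move=> i lei; apply: (K2 _ C2) => //; rewrite ey ea; apply: B2.
Qed.
End LdClosure.

(** * Finite vocabularies *)

Lemma finite_set_list (T : Type) (B : set T) :
  finite_set B -> exists s : seq {classic T}, B = [set` s].
Proof. by move/(@finite_seqP {classic T}). Qed.

Definition voc_sub (Sg : signature) (t t' : vocabulary Sg) : Prop :=
  vfun t `<=` vfun t' /\ vrel t `<=` vrel t'.

Definition finite_voc (Sg : signature) (t : vocabulary Sg) : Prop :=
  finite_set (vfun t) /\ finite_set (vrel t).

(** Asking for [P] in every vocabulary above [t0] lets finitely many supports be merged by union. *)
Definition finitely_supported (Sg : signature) (t : vocabulary Sg)
    (P : vocabulary Sg -> Prop) : Prop :=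
  exists t0, [/\ finite_voc t0, voc_sub t0 t & forall t1, voc_sub t0 t1 -> P t1].

Lemma finitely_supported_bigcap (Sg : signature) (t : vocabulary Sg) (I : Type)
    (D : set I) (P : I -> vocabulary Sg -> Prop) :
  finite_set D -> (forall i, D i -> finitely_supported t (P i)) ->
  finitely_supported t (fun t1 => forall i, D i -> P i t1).
Proof.
move=> finD fsP.
have /choice[F FP] : forall i, exists t0, D i ->
    [/\ finite_voc t0, voc_sub t0 t & forall t1, voc_sub t0 t1 -> P i t1].
  move=> i; have [/fsP[t0 t0P]|nD] := pselect (D i); first by exists t0.
  by exists t.
exists (Vocabulary (\bigcup_(i in D) vfun (F i)) (\bigcup_(i in D) vrel (F i))); split.
- by split; apply: bigcup_finite => // i /FP[[]].
- by split; apply: bigcup_sub => i /FP[_ []].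
move=> t1 [sf sr] i Di; have [_ _] := FP i Di; apply.
by split=> x xt; [apply: sf|apply: sr]; exists i.
Qed.

Lemma finitely_supported_and (Sg : signature) (t : vocabulary Sg)
    (P Q : vocabulary Sg -> Prop) :
  finitely_supported t P -> finitely_supported t Q ->
  finitely_supported t (fun t1 => P t1 /\ Q t1).
Proof.
move=> fP fQ.
have [||t0 [f0 s0 t0P]] := @finitely_supported_bigcap Sg t bool setT (fun b => if b then P else Q).
- exact: finite_finset.
- by case.
exists t0; split=> // t1 s1.
by split; [apply: (t0P t1 s1 true)|apply: (t0P t1 s1 false)].
Qed.

Lemma finitely_supported_ord (Sg : signature) (t : vocabulary Sg) (m : nat)
    (P : 'I_m -> vocabulary Sg -> Prop) :
  (forall i, finitely_supported t (P i)) ->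
  finitely_supported t (fun t1 => forall i, P i t1).
Proof.
move=> fP; have [||t0 [f0 s0 t0P]] := @finitely_supported_bigcap Sg t 'I_m setT P.
- exact: finite_finset.
- by move=> i _.
by exists t0; split=> // t1 s1 i; apply: t0P.
Qed.

Lemma finitely_supported_const (Sg : signature) (t : vocabulary Sg) :
  finitely_supported t (fun=> True).
Proof.
exists (Vocabulary set0 set0).
by split=> //; split => //; apply: finite_set0.
Qed.

Lemma finitely_supported_fun (Sg : signature) (t : vocabulary Sg) (f : fun_sym Sg) :
  vfun t f -> finitely_supported t (fun t1 => vfun t1 f).
Proof.
move=> tf; exists (Vocabulary [set f] set0).
split=> [||t1 [/(_ f erefl)]] //; last by split=> // _ ->.
by split; [apply: finite_set1|apply: finite_set0].
Qed.

Lemma finitely_supported_rel (Sg : signature) (t : vocabulary Sg) (r : rel_sym Sg) :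
  vrel t r -> finitely_supported t (fun t1 => vrel t1 r).
Proof.
move=> tr; exists (Vocabulary set0 [set r]).
split=> [||t1 [_ /(_ r erefl)]] //; last by split=> // _ ->.
by split; [apply: finite_set0|apply: finite_set1].
Qed.

Lemma term_finitely_supported (Sg : signature) (t : vocabulary Sg) (n : nat)
    (u : term Sg n) : term_in t u -> finitely_supported t (fun t1 => term_in t1 u).
Proof.
elim: u => [i _|f a IH [tf ta]]; first exact: finitely_supported_const.
apply: finitely_supported_and; first exact: finitely_supported_fun.
apply: (finitely_supported_ord (P := fun i t1 => term_in t1 (a i))) => i.
exact: IH (ta i).
Qed.

Lemma fo_finitely_supported (Sg : signature) (t : vocabulary Sg) (n : nat)
    (phi : fo Sg n) : fo_in t phi -> finitely_supported t (fun t1 => fo_in t1 phi).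
Proof.
elim: phi => {n} [n _|n t1 t2 [u1 u2]|n r a [tr ta]|n p IH|n p IHp q IHq [tp tq]
  |n p IHp q IHq [tp tq]|n p IH|n p IH] //=.
- exact: finitely_supported_const.
- by apply: finitely_supported_and; apply: term_finitely_supported.
- apply: finitely_supported_and; first exact: finitely_supported_rel.
  by apply: finitely_supported_ord => i; apply: term_finitely_supported.
- by apply: finitely_supported_and; [apply: IHp|apply: IHq].
- by apply: finitely_supported_and; [apply: IHp|apply: IHq].
Qed.

Lemma finitely_supported_add_rel (Sg : signature) (t : vocabulary Sg) (k : nat)
    (P : vocabulary (add_rel Sg k) -> Prop) :
  finitely_supported (vadd_rel k t) P ->
  finitely_supported t (fun t1 => P (vadd_rel k t1)).
Proof.
case=> t0 [[f0 r0] [sf sr] PP]; exists (@Vocabulary Sg (vfun t0) (Some @^-1` vrel t0)); split.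
- by split=> //; apply: (finite_preimage _ r0) => x y _ _ [].
- by split=> // r /sr.
by move=> t1 [s1 s2]; apply: PP; split=> // -[r|] // /s2.
Qed.

Lemma ld_finitely_supported (Sg : signature) (n : nat) (phi : ld Sg n)
    (t : vocabulary Sg) :
  ld_in t phi -> finitely_supported t (fun t1 => ld_in t1 phi).
Proof.
elim: phi t => {Sg n}
  [Sg n p|Sg n p IHp q IHq|Sg n p IHp q IHq|Sg n p IH|Sg n p IH|Sg n k p IH
  |Sg n p0 IH0 p1 IH1 p2 IH2 p3 IH3 p4 IH4] t //=.
- exact: fo_finitely_supported.
- by case=> tp tq; apply: finitely_supported_and; [apply: IHp|apply: IHq].
- by case=> tp tq; apply: finitely_supported_and; [apply: IHp|apply: IHq].
- exact: IH.
- exact: IH.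
- by move=> tp; apply: (@finitely_supported_add_rel _ _ k (fun t1 => ld_in t1 p)); apply: IH.
case=> /IH0 F0 /IH1 F1 /IH2 F2 /IH3 F3 /IH4 F4.
have [t0 [f0 s0 t0P]] := finitely_supported_and F0 (finitely_supported_and F1
  (finitely_supported_and F2 (finitely_supported_and F3 F4))).
by exists t0; split=> // t1 /t0P[? [? [? []]]].
Qed.

(** * Ehrenfeucht-Fraisse games *)

Section Games.
Variables (Sg : signature) (t : vocabulary Sg).

(** A partial isomorphism between the first [n] listed points. Functions enter through their graphs,
    since a value need not be among those points. *)
Definition agree (M1 M2 : structure Sg) (n : nat) (u : nat -> M1) (w : nat -> M2) : Prop :=
  [/\ forall i j, i < n -> j < n -> (u i = u j <-> w i = w j),
      forall r, vrel t r -> forall a : 'I_(rarity r) -> nat, (forall i, a i < n) ->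
        (rint (u \o a) <-> rint (w \o a))
    & forall f, vfun t f -> forall (a : 'I_(farity f) -> nat) j, (forall i, a i < n) ->
        j < n -> (fint (u \o a) = u j <-> fint (w \o a) = w j)].

(** Used with a shift to forget the last round, and with a reversal to list rounds in the order of
    play. *)
Lemma agree_reindex (M1 M2 : structure Sg) (n m : nat) (g : nat -> nat)
    (u u' : nat -> M1) (w w' : nat -> M2) :
  (forall i, i < m -> [/\ g i < n, u (g i) = u' i & w (g i) = w' i]) ->
  agree n u w -> agree m u' w'.
Proof.
move=> gP [Ae Ar Af].
have aE k (a : 'I_k -> nat) : (forall i, a i < m) ->
    [/\ forall i, g (a i) < n, u \o (g \o a) = u' \o a & w \o (g \o a) = w' \o a].
  move=> am; split; first by move=> i; case: (gP _ (am i)).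
    by apply: funext => i /=; case: (gP _ (am i)).
  by apply: funext => i /=; case: (gP _ (am i)).
split=> [i j /gP[gi <- <-] /gP[gj <- <-]|r tr a /aE[ga <- <-]|f tf a j /aE[ga <- <-] /gP[gj <- <-]].
- exact: Ae.
- exact: Ar.
- exact: Af.
Qed.

(* The second player survives [k] more rounds from the position where [u] and [w] were
   played in the first [n] rounds, the last round having index 0. *)
Fixpoint ef (M1 M2 : structure Sg) (k n : nat) (u : nat -> M1) (w : nat -> M2) : Prop :=
  match k with
  | 0 => agree n u w
  | k'.+1 => (forall x, exists y, ef k' n.+1 (ucons x u) (ucons y w)) /\
             (forall y, exists x, ef k' n.+1 (ucons x u) (ucons y w))
  end.

Lemma ef_agree (M1 M2 : structure Sg) (k n : nat) (u : nat -> M1) (w : nat -> M2) :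
  ef k n u w -> agree n u w.
Proof.
elim: k n u w => [//|k IH] n u w [forth _].
case: (carrier_inhabited M1) => x; have [y /IH] := forth x.
by apply: (@agree_reindex _ _ _ _ S) => i ltin.
Qed.

Lemma finite_set_ord_fun (m n : nat) : finite_set [set: 'I_m -> 'I_n].
Proof.
apply: (@sub_finite_set _ _ ((fun (a : {ffun 'I_m -> 'I_n}) => a : 'I_m -> 'I_n) @` setT)).
  by move=> a _; exists [ffun i => a i] => //; apply: funext => i; rewrite ffunE.
by apply: finite_image; apply: finite_finset.
Qed.

(** The set [Psi] consists of the conjunctions that contain, for each formula of [Phi], either it or
    its negation. *)
Lemma complete_types (n : nat) (Phi : set (fo Sg n)) : finite_set Phi ->
  (forall phi, Phi phi -> fo_in t phi) ->
  exists Psi : set (fo Sg n), [/\ finite_set Psi, forall psi, Psi psi -> fo_in t psi &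
    forall (M : structure Sg) (v : 'I_n -> M), exists psi, [/\ Psi psi, fo_sat v psi &
      forall (M' : structure Sg) (v' : 'I_n -> M'), fo_sat v' psi ->
        forall phi, Phi phi -> (fo_sat v phi <-> fo_sat v' phi)]].
Proof.
move=> /finite_set_list[s ->]; elim: s => [|p s IH] sin.
  exists [set FONot FOFalse]; split=> [|_ ->//|M v]; first exact: finite_set1.
  by exists (FONot FOFalse); split=> //= [[]|].
have [|Psi [Pf Pin Pv]] := IH; first by move=> phi sphi; apply: sin; rewrite /= inE sphi orbT.
have tp : fo_in t p by apply: sin; rewrite /= inE eqxx.
exists ((FOAnd p @` Psi) `|` (FOAnd (FONot p) @` Psi)); split.
- by rewrite finite_setU; split; apply: finite_image.
- by move=> _ [] [psi /Pin tpsi <-].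
move=> M v; have [psi [Ppsi vpsi psiP]] := Pv M v.
have [vp|np] := pselect (fo_sat v p).
  exists (FOAnd p psi); split=> //; first by left; exists psi.
  move=> M' v' [v'p v'psi] phi; rewrite /= inE => /predU1P[->//|].
  exact: psiP v'psi phi.
exists (FOAnd (FONot p) psi); split=> //; first by right; exists psi.
move=> M' v' [v'p v'psi] phi; rewrite /= inE => /predU1P[->//|].
exact: psiP v'psi phi.
Qed.

(** Finite vocabularies make each stage finite: the next stage existentially quantifies the complete
    types of the previous one. *)
Lemma ef_formulas (k n : nat) : finite_voc t ->
  exists Phi : set (fo Sg n), [/\ finite_set Phi, forall phi, Phi phi -> fo_in t phi &
    forall (M1 M2 : structure Sg) (u : nat -> M1) (w : nat -> M2),
      (forall phi, Phi phi ->
        (fo_sat (fun i : 'I_n => u i) phi <-> fo_sat (fun i : 'I_n => w i) phi)) ->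
      ef k n u w].
Proof.
move=> [tf tr]; elim: k n => [|k IH] n.
  (* With no rounds left, the unnested atomic formulas express exactly [agree]. *)
  exists ((fun ij : 'I_n * 'I_n => FOEq (Var ij.1) (Var ij.2)) @` setT `|`
    ((\bigcup_(r in vrel t) ((fun a => @FORel Sg n r (fun i => Var (a i))) @` setT)) `|`
    (\bigcup_(f in vfun t)
      ((fun aj : ('I_(farity f) -> 'I_n) * 'I_n =>
         FOEq (@App Sg n f (fun i => Var (aj.1 i))) (Var aj.2)) @` (setT `*` setT))))).
  split.
  - rewrite !finite_setU; split; first by apply: finite_image; apply: finite_finset.
    split; apply: bigcup_finite => // x _; apply: finite_image.
      exact: finite_set_ord_fun.
    by apply: finite_setX; [apply: finite_set_ord_fun|apply: finite_finset].
  - by move=> _ [[ij _ <-]//|[[r tr' [a _ <-]]//|[f tf' [aj _ <-]]//]].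
  move=> M1 M2 u w uw.
  have aE m (a : 'I_m -> nat) : (forall i, a i < n) ->
      exists b : 'I_m -> 'I_n, a = (fun i => b i : nat).
    by move=> lta; exists (fun i => Ordinal (lta i)).
  split=> [i j lti ltj|r tr' a /aE[b ->]|f tf' a j /aE[b ->] ltj].
  - by apply: (uw (FOEq (Var (Ordinal lti)) (Var (Ordinal ltj)))); left;
      exists (Ordinal lti, Ordinal ltj).
  - by apply: (uw (@FORel Sg n r (fun i => Var (b i)))); right; left; exists r => //; exists b.
  - apply: (uw (FOEq (@App Sg n f (fun i => Var (b i))) (Var (Ordinal ltj)))).
    by right; right; exists f => //; exists (b, Ordinal ltj).
have [Phi [Pf Pin PP]] := IH n.+1.
have [Psi [Qf Qin QP]] := complete_types Pf Pin.
exists (@FOEx Sg n @` Psi); split; first exact: finite_image.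
  by move=> _ [psi /Qin tpsi <-].
move=> M1 M2 u w uw; split=> [x|y].
  (* A move [x] is answered by any [y] of the same complete type, whose existence is one of the
     formulas in the set. *)
  have [psi [Ppsi xpsi psiP]] := QP M1 (fun i => ucons x u i).
  have Epsi : (@FOEx Sg n @` Psi) (FOEx psi) by exists psi.
  have [|y ypsi] := iffLR (uw _ Epsi).
    by exists x; rewrite vcons_ucons.
  by rewrite vcons_ucons in ypsi; exists y; apply: PP => phi; apply: psiP.
have [psi [Ppsi ypsi psiP]] := QP M2 (fun i => ucons y w i).
have Epsi : (@FOEx Sg n @` Psi) (FOEx psi) by exists psi.
have [|x xpsi] := iffRL (uw _ Epsi).
  by exists y; rewrite vcons_ucons.
rewrite vcons_ucons in xpsi; exists x; apply: PP => phi Pphi.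
by apply: iff_sym; apply: psiP.
Qed.

Lemma elementarily_equivalent_ef (M1 M2 : structure Sg) (k : nat) (u : nat -> M1)
    (w : nat -> M2) : finite_voc t ->
  (forall phi : fo Sg 0, fo_in t phi -> (fo_sat (@no_vars M1) phi <-> fo_sat (@no_vars M2) phi)) ->
  ef k 0 u w.
Proof.
move=> ft M12; have [Phi [_ Pin PP]] := ef_formulas k 0 ft.
apply: PP => phi /Pin /M12.
have nv (M : structure Sg) (v : 'I_0 -> M) : v = @no_vars M by apply: funext => -[].
by rewrite -(nv _ (fun i : 'I_0 => u i)) -(nv _ (fun i : 'I_0 => w i)).
Qed.

End Games.

(** * Back-and-forth with bookkeeping *)

Lemma injective_unbounded (f : nat -> nat) (K : nat) : injective f -> exists N, K <= f N.
Proof.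
move=> fi; apply: contrapT => /forallNP ltK.
have /uniq_leq_size := etrans (map_inj_uniq fi (iota 0 K.+1)) (iota_uniq 0 K.+1).
move=> /(_ (iota 0 K)); rewrite size_map !size_iota ltnn => H.
suff : false by []. apply: H => _ /mapP[N _ ->].
by rewrite mem_iota /= ltnNge; apply/negP/ltK.
Qed.

(* Every task [(b, idx, j)] is decoded at arbitrarily late stages, in particular when all
   the elements with index in [idx] are already chosen. *)
Lemma back_and_forth (X Y : Type) (G : seq (X * Y) -> Prop)
    (C1 : seq X -> nat -> X) (C2 : seq Y -> nat -> Y) :
  G [::] -> (forall s x, G s -> exists y, G ((x, y) :: s)) ->
  (forall s y, G s -> exists x, G ((x, y) :: s)) ->
  exists z : nat -> X * Y, [/\ forall n, G (rev (mkseq z n)),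
    closed_under C1 (fun n => (z n).1) & closed_under C2 (fun n => (z n).2)].
Proof.
(* The closure functions themselves supply default elements of [X] and [Y]. *)
move=> G0 forth back; pose d := (C1 [::] 0, C2 [::] 0).
pose el (s : seq (X * Y)) i := nth d (rev s) i.
(* A history is stored with its latest pair first. At stage [m] the pair obeys the task coded by
   [m]: the bit selects the side on which the element is prescribed, and the other side answers. *)
pose spec (ms : nat * seq (X * Y)) p := G ms.2 -> G (p :: ms.2) /\
  if (unpickle ms.1 : option (bool * seq nat * nat * nat)) is Some (b, idx, j, _) then
    if b then p.1 = C1 [seq (el ms.2 i).1 | i <- idx] j
    else p.2 = C2 [seq (el ms.2 i).2 | i <- idx] j
  else True.
have /choice[F FP] : forall ms, exists p, spec ms p.
  move=> [m s]; rewrite /spec /=; have [Gs|nG] := pselect (G s); last by exists d.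
  case: unpickle => [[[[b idx] j] N]|]; last by have [y] := forth s d.1 Gs; exists (d.1, y).
  case: b.
    set x := C1 _ j; have [y Gy] := forth s x Gs; by exists (x, y).
  set y := C2 _ j; have [x Gx] := back s y Gs; by exists (x, y).
pose st := fix st m := if m is m'.+1 then F (m', st m') :: st m' else [::].
pose z m := F (m, st m).
have stE m : st m = rev (mkseq z m) by elim: m => // m IH; rewrite mkseqS rev_rcons -IH.
have Gst m : G (st m) by elim: m => //= m IH; case: (FP (m, st m) IH).
have elz m i : i < m -> el (st m) i = z i.
  by move=> lti; rewrite /el stE revK nth_mkseq.
have task b (idx : seq nat) j : exists m, (forall i, i \in idx -> i < m) /\
    if b : bool then (z m).1 = C1 [seq (z i).1 | i <- idx] j
    else (z m).2 = C2 [seq (z i).2 | i <- idx] j.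
  (* The last component [N] gives a single task infinitely many codes, one of which exceeds every
     index in [idx]. *)
  have [|N leN] := @injective_unbounded (fun N => pickle (b, idx, j, N)) (\max_(i <- idx) i).+1.
    by move=> N N' /(pcan_inj pickleK)[].
  set m := pickle _ in leN; exists m.
  have lt i : i \in idx -> i < m.
    by move=> ii; apply: leq_trans leN; rewrite ltnS; apply: leq_bigmax_seq.
  split=> //; have [_] := FP (m, st m) (Gst m); rewrite /= pickleK.
  case: b @m leN lt => m leN lt; rewrite -/(z m) => ->; congr (_ _ j);
    by apply/eq_in_map => i /lt /elz ->.
exists z; split=> [n|s j|s j]; first by rewrite -stE.
  by have [m [_ mE]] := task true s j; exists m.
by have [m [_ mE]] := task false s j; exists m.
Qed.

(** * Amalgamation and compactness *)

(** The range of a sequence must be closed under the functions before it can carry a substructure.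
    The finitely many symbols are listed, and [j] selects the symbol to apply. *)
Lemma fun_closure (Sg : signature) (t : vocabulary Sg) (M : structure Sg) :
  finite_voc t -> exists C : seq M -> nat -> M, forall (N : Type) (e : N -> M),
    closed_under C e -> forall f, vfun t f -> forall a : 'I_(farity f) -> N,
    exists y, e y = fint (e \o a).
Proof.
case=> /finite_set_list[s sE] _; case: (carrier_inhabited M) => d.
exists (fun l j => if onth s j is Some f then fint (fun i : 'I_(farity f) => nth d l i) else d).
move=> N e cl f; rewrite sE /= => sf a.
have [y ey] := cl (codom a) (index (f : {classic _}) s); exists y.
have onthE : onth s (index (f : {classic _}) s) = Some f.
  by rewrite (onthE) (nth_map (f : {classic _})) ?index_mem // nth_index.
rewrite {}ey onthE; congr fint; apply: funext => i.
by rewrite -map_comp (nth_map i) ?size_enum_ord // nth_ord_enum.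
Qed.

Section Amalgam.
Variables (Sg : signature) (t1 t2 : vocabulary Sg) (M1 M2 : structure Sg).
Variables (a : nat -> M1) (b : nat -> M2).
Hypothesis ab : forall n, agree (vocI t1 t2) n a b.

Lemma agree_eq i j : a i = a j <-> b i = b j.
Proof.
have [ae _ _] := ab (maxn i j).+1.
by apply: ae; rewrite ltnS ?leq_maxl ?leq_maxr.
Qed.

Lemma ord_fun_bounded m (g : 'I_m -> nat) : exists n, forall i, g i < n.
Proof.
by exists (\max_i g i).+1 => i; rewrite ltnS; apply: leq_bigmax.
Qed.

Lemma agree_rint r (g : 'I_(rarity r) -> nat) : vrel t1 r -> vrel t2 r ->
  rint (a \o g) <-> rint (b \o g).
Proof.
by move=> r1 r2; have [n gn] := ord_fun_bounded g; have [_ ar _] := ab n; apply: ar.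
Qed.

Lemma agree_fint f (g : 'I_(farity f) -> nat) j : vfun t1 f -> vfun t2 f ->
  fint (a \o g) = a j <-> fint (b \o g) = b j.
Proof.
move=> f1 f2; have [n gn] := ord_fun_bounded g.
have [_ _ af] := ab (maxn n j.+1).
by apply: af => // [i|]; rewrite leq_max ?gn ?leqnn ?orbT.
Qed.

(** By [agree_eq] the ranges of [a] and [b] are in bijection, so one universe carries both
    vocabularies; on common symbols the two pulled back interpretations coincide. *)
Lemma amalgam (C1 : seq M1 -> nat -> M1) (C2 : seq M2 -> nat -> M2) :
  closed_under C1 a -> closed_under C2 b ->
  (forall f, vfun t1 f -> forall g : 'I_(farity f) -> nat, exists n, a n = fint (a \o g)) ->
  (forall f, vfun t2 f -> forall g : 'I_(farity f) -> nat, exists n, b n = fint (b \o g)) ->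
  exists (N : structure Sg) (e1 : N -> M1) (e2 : N -> M2),
    [/\ embedding t1 e1, embedding t2 e2, closed_under C1 e1 & closed_under C2 e2].
Proof.
move=> cl1 cl2 fa fb.
(* The sequences may repeat values, so the universe is the range of [a] rather than [nat]. *)
pose N := {x | exists n, x = a n}.
pose ix (x : N) := sval (cid (svalP x)).
pose mk n : N := exist _ (a n) (ex_intro _ n erefl).
pose e1 (x : N) := a (ix x); pose e2 (x : N) := b (ix x).
have aix (x : N) : a (ix x) = sval x by rewrite /ix; case: cid.
have e1mk n : e1 (mk n) = a n by rewrite /e1 aix.
have e2mk n : e2 (mk n) = b n by apply/agree_eq; apply: e1mk.
(* The closure of one side names the value; for a common symbol, [agree_fint] makes the same index
   correct on the other side. *)
have /choice[F FP] : forall fx : {f & 'I_(farity f) -> N}, exists y : N,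
    (vfun t1 (tag fx) -> e1 y = fint (e1 \o tagged fx)) /\
    (vfun t2 (tag fx) -> e2 y = fint (e2 \o tagged fx)).
  move=> [f x] /=; have [f1|nf1] := pselect (vfun t1 f); last first.
    have [f2|nf2] := pselect (vfun t2 f); last by exists (mk 0).
    by have [n bn] := fb f f2 (ix \o x); exists (mk n); split=> // _; rewrite e2mk.
  have [n an] := fa f f1 (ix \o x); exists (mk n); split=> [_|f2]; first by rewrite e1mk.
  by rewrite e2mk; apply/esym/(agree_fint (ix \o x) n f1 f2).
(* For a common relation symbol either disjunct implies the other by [agree_rint]. *)
exists (@Structure Sg N (inhabits (mk 0)) (fun f x => F (existT _ f x))
  (fun r x => (vrel t1 r /\ rint (e1 \o x)) \/ (vrel t2 r /\ rint (e2 \o x)))), e1, e2.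
split.
- split=> [[x px] [y py]|f tf x|r tr x] /=.
  + by rewrite /e1 !aix /= => xy; apply: eq_exist.
  + by have [-> //] := FP (existT _ f x).
  + split=> [[[//]|[tr2]]|]; last by left.
    exact: (iffRL (agree_rint (ix \o x) tr tr2)).
- split=> [[x px] [y py]|f tf x|r tr x] /=.
  + by move/agree_eq; rewrite !aix /= => xy; apply: eq_exist.
  + by have [_ -> //] := FP (existT _ f x).
  + split=> [[[tr1]|[//]]|]; last by right.
    exact: (iffLR (agree_rint (ix \o x) tr1 tr)).
- move=> s j; have [n an] := cl1 (map ix s) j; exists (mk n).
  by rewrite e1mk an -map_comp.
- move=> s j; have [n bn] := cl2 (map ix s) j; exists (mk n).
  by rewrite e2mk bn -map_comp.
Qed.
End Amalgam.

(** * Infinite games on ultrapowers *)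

Section UltrapowerGame.
Variables (Sg : signature) (t : vocabulary Sg) (M1 M2 : structure Sg).
Context (U : set_system nat) {FU : UltraFilter U}.
Hypothesis cofinal : forall n, U [set i | n <= i].
Hypothesis M12 : forall k (u : nat -> M1) (w : nat -> M2), ef t k 0 u w.

Let P1 := ultraproduct U (fun _ : nat => M1).
Let P2 := ultraproduct U (fun _ : nat => M2).

(** Equality, relations and function graphs in an ultrapower are statements about [U]-large sets, so
    equivalences holding almost everywhere lift. *)
Lemma agree_ultrapower (n : nat) (u : nat -> P1) (w : nat -> P2) :
  U [set i | agree t n (fun j => urepr (u j) i) (fun j => urepr (w j) i)] ->
  agree t n u w.
Proof.
have transfer (p q : set nat) : U [set i | p i <-> q i] -> (U p <-> U q).
  by move=> pq; split; apply: filterS2 pq => i /= [].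
move=> Uag; split=> [i j lti ltj|r tr a an|f tf a j an ltj].
- rewrite -(ureprK (u i)) -(ureprK (u j)) -(ureprK (w i)) -(ureprK (w j)) !ucls_eq.
  apply: transfer; apply: filterS Uag => m [ae _ _].
  exact: ae.
- by apply: transfer; apply: filterS Uag => m [_ ar _]; apply: ar.
- rewrite -(ureprK (u j)) -(ureprK (w j)) /= !ucls_eq.
  apply: transfer; apply: filterS Uag => m [_ _ af].
  exact: af.
Qed.

(** In coordinate [i] a game of [i] rounds is played, of which [i - size s] remain. Any finite
    history leaves rounds to play in almost every coordinate. *)
Let pos (s : seq (P1 * P2)) (d : P1 * P2) : set nat :=
  [set i | size s <= i /\ ef t (i - size s) (size s)
    (fun j => urepr (nth d s j).1 i) (fun j => urepr (nth d s j).2 i)].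

Lemma ultrapower_back_and_forth (C1 : seq P1 -> nat -> P1) (C2 : seq P2 -> nat -> P2) :
  exists (a : nat -> P1) (b : nat -> P2),
    [/\ forall n, agree t n a b, closed_under C1 a & closed_under C2 b].
Proof.
case: (carrier_inhabited P1) => d1; case: (carrier_inhabited P2) => d2.
pose d := (d1, d2).
have uE (s : seq (P1 * P2)) p i : (fun j => urepr (nth d (p :: s) j).1 i) =
    ucons (urepr p.1 i) (fun j => urepr (nth d s j).1 i).
  by apply: funext => -[|j].
have wE (s : seq (P1 * P2)) p i : (fun j => urepr (nth d (p :: s) j).2 i) =
    ucons (urepr p.2 i) (fun j => urepr (nth d s j).2 i).
  by apply: funext => -[|j].
have [|s x Us|s y Us|z [zP cl1 cl2]] :=
  @back_and_forth P1 P2 (fun s => U (pos s d)) C1 C2.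
- by apply: filterS (cofinal 0) => i _; split=> //; apply: M12.
- have [] := @filter_choice nat U (fun=> M2) (fun i y => size s < i /\
    ef t (i - (size s).+1) (size s).+1 (ucons (urepr x i) (fun j => urepr (nth d s j).1 i))
      (ucons y (fun j => urepr (nth d s j).2 i))) _ (fun=> carrier_inhabited M2).
    apply: filterS2 (cofinal (size s).+1) Us => i /= lti [_].
    (* A positive number of rounds remains in coordinate [i]; the reply there spends one of them. *)
    have := lti; rewrite subnS -subn_gt0; case: (i - size s) => // k _.
    by case=> /(_ (urepr x i))[y] ? _; exists y.
  move=> y yP; exists (ucls U y); apply: filterS2 (urepr_ucls y) yP => i /= yi [lti].
  by rewrite /pos /= uE wE /= yi.
- have [] := @filter_choice nat U (fun=> M1) (fun i x => size s < i /\
    ef t (i - (size s).+1) (size s).+1 (ucons x (fun j => urepr (nth d s j).1 i))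
      (ucons (urepr y i) (fun j => urepr (nth d s j).2 i))) _ (fun=> carrier_inhabited M1).
    apply: filterS2 (cofinal (size s).+1) Us => i /= lti [_].
    have := lti; rewrite subnS -subn_gt0; case: (i - size s) => // k _.
    by case=> _ /(_ (urepr y i))[x] ?; exists x.
  move=> x xP; exists (ucls U x); apply: filterS2 (urepr_ucls x) xP => i /= xi [lti].
  by rewrite /pos /= uE wE /= xi.
exists (fun n => (z n).1), (fun n => (z n).2); split=> // n.
have := zP n; rewrite /pos size_rev size_mkseq => Upos.
have : agree t n (fun j => (nth d (rev (mkseq z n)) j).1) (fun j => (nth d (rev (mkseq z n)) j).2).
  by apply: agree_ultrapower; apply: filterS Upos => i [_ /ef_agree].
(* The history lists the latest pair first, so round [j] is found at index [n - j.+1]. *)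
apply: (@agree_reindex _ _ _ _ _ _ (fun j => n - j.+1)) => i lti.
have ltn : n - i.+1 < n by rewrite ltn_subrL (leq_ltn_trans _ lti).
have nthE : nth d (rev (mkseq z n)) (n - i.+1) = z i.
  by rewrite nth_rev size_mkseq // subnSK // (subKn (ltnW lti)) nth_mkseq.
by rewrite nthE; split.
Qed.
End UltrapowerGame.

(** * Joint models of finite fragments and compactness *)

Section RobinsonConsistency.
Variables (A : set (nat -> bool)) (Sg : signature).
Hypothesis A_codense : cantor_dense (~` A).

Lemma ld_closure_seq (l : seq {classic ld Sg 0}) (M : structure Sg) :
  exists C : seq M -> nat -> M, forall (t : vocabulary Sg) (N : structure Sg) (e : N -> M),
    embedding t e -> closed_under C e -> forall phi, phi \in l -> ld_in t phi ->
    ld_sat A phi (@no_vars M) -> ld_sat A phi (@no_vars N).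
Proof.
elim: l => [|psi l [C1 IH]].
  by case: (carrier_inhabited M) => d; exists (fun _ _ => d).
have [C2 CP] := ld_closure A psi M.
exists (closure2 C1 C2) => t N e et /closed_under2[cl1 cl2] phi.
rewrite inE => /predU1P[-> tpsi Mpsi|]; last exact: IH cl1 phi.
apply: (CP t N e et cl2 tpsi).
by rewrite (_ : e \o _ = @no_vars M) //; apply: funext => -[].
Qed.

(** Any ultrafilter refining the eventual sets works; the identity then plays the part of
    [kappa]. *)
Lemma nat_ultrafilter : exists U : set_system nat,
  UltraFilter U /\ forall n, U [set i | n <= i].
Proof.
have [U [FU sU]] := ultraFilterLemma (eventually_filter : ProperFilter eventually).
by exists U; split=> // n; apply: sU; exists n.
Qed.

Lemma ld_ultraproduct_sentence (I : Type) (U : set_system I) (FU : UltraFilter U)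
    (kappa : I -> nat) (kappaP : forall n, U [set i | n <= kappa i])
    (M : I -> structure Sg) (phi : ld Sg 0) :
  U [set i | ld_sat A phi (@no_vars (M i))] ->
  ld_sat A phi (@no_vars (ultraproduct U M)).
Proof.
pose v (j : 'I_0) : forall i, M i := match notF (ltn_ord j) with end.
have nv (N : Type) (w : 'I_0 -> N) : w = @no_vars N by apply: funext => -[].
move=> UM; rewrite -(nv _ (fun j => ucls U (v j))).
apply: (ld_ultraproduct A_codense kappaP).
by apply: filterS UM => i /=; rewrite (nv _ (fun j => v j i)).
Qed.

Lemma joint_fragment (t1 t2 : vocabulary Sg) (M1 M2 : structure Sg)
    (l1 l2 : seq {classic ld Sg 0}) :
  (forall phi : fo Sg 0, fo_in (vocI t1 t2) phi ->
    (fo_sat (@no_vars M1) phi <-> fo_sat (@no_vars M2) phi)) ->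
  (forall phi, phi \in l1 -> ld_in t1 phi /\ ld_sat A phi (@no_vars M1)) ->
  (forall phi, phi \in l2 -> ld_in t2 phi /\ ld_sat A phi (@no_vars M2)) ->
  exists N : structure Sg, forall phi, phi \in l1 \/ phi \in l2 -> ld_sat A phi (@no_vars N).
Proof.
move=> M12 l1P l2P.
have finl (l : seq {classic ld Sg 0}) t (M : structure Sg) :
    (forall phi, phi \in l -> ld_in t phi /\ ld_sat A phi (@no_vars M)) ->
    finitely_supported t (fun t' => forall phi, phi \in l -> ld_in t' phi).
  move=> lP; apply: (@finitely_supported_bigcap _ _ _ [set` l] (fun phi t' => ld_in t' phi)).
    exact: finite_seq.
  by move=> phi /lP[tphi _]; apply: ld_finitely_supported.
(* Finite vocabularies carrying the fragments are needed both for the games and for closure under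
   functions. *)
have [s1 [f1 [st1 sr1] /(_ s1 _)s1P]] := finl l1 t1 M1 l1P.
have [s2 [f2 [st2 sr2] /(_ s2 _)s2P]] := finl l2 t2 M2 l2P.
have {}s1P := s1P (conj (fun _ x => x) (fun _ x => x)).
have {}s2P := s2P (conj (fun _ x => x) (fun _ x => x)).
have f0 : finite_voc (vocI s1 s2).
  by split; apply: finite_setIl; [case: f1|case: f1].
have M12' (phi : fo Sg 0) : fo_in (vocI s1 s2) phi ->
    (fo_sat (@no_vars M1) phi <-> fo_sat (@no_vars M2) phi).
  (* Monotonicity of [fo_in] in the vocabulary is read off the finite support. *)
  move=> /fo_finitely_supported[t0 [_ [sf sr] t0P]]; apply/M12/t0P.
  by split=> x; [case/sf => /st1 ? /st2|case/sr => /sr1 ? /sr2].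
have [U [FU cofinal]] := nat_ultrafilter.
pose P1 := ultraproduct U (fun=> M1); pose P2 := ultraproduct U (fun=> M2).
have P1P phi : phi \in l1 -> ld_sat A phi (@no_vars P1).
  move=> /l1P[_ M1phi]; apply: (ld_ultraproduct_sentence _ cofinal).
  exact: filterE.
have P2P phi : phi \in l2 -> ld_sat A phi (@no_vars P2).
  move=> /l2P[_ M2phi]; apply: (ld_ultraproduct_sentence _ cofinal).
  exact: filterE.
have [[C1 C1P] [C2 C2P]] := (ld_closure_seq l1 P1, ld_closure_seq l2 P2).
have [[D1 D1P] [D2 D2P]] := (fun_closure P1 f1, fun_closure P2 f2).
have game k u w : @ef _ (vocI s1 s2) M1 M2 k 0 u w by apply: elementarily_equivalent_ef.
have [a [b [ab cl1 cl2]]] :=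
  ultrapower_back_and_forth cofinal game (closure2 C1 D1) (closure2 C2 D2).
(* The closures [D1] and [D2] are used before amalgamation, to define the functions; [C1] and [C2]
   are used after it, to transfer truth. *)
have [/closed_under2[_ clD1] /closed_under2[_ clD2]] := (cl1, cl2).
have [N [e1 [e2 [E1 E2 {}cl1 {}cl2]]]] := amalgam ab cl1 cl2 (D1P _ _ clD1) (D2P _ _ clD2).
have [/closed_under2[clC1 _] /closed_under2[clC2 _]] := (cl1, cl2).
exists N => phi [lphi|lphi].
  exact: C1P E1 clC1 phi lphi (s1P phi lphi) (P1P phi lphi).
exact: C2P E2 clC2 phi lphi (s2P phi lphi) (P2P phi lphi).
Qed.

Lemma compactness (T : set (ld Sg 0)) :
  (forall l : seq {classic ld Sg 0}, [set` l] `<=` T ->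
    exists N : structure Sg, forall phi, phi \in l -> ld_sat A phi (@no_vars N)) ->
  consistent A T.
Proof.
(* Pairing each finite list with a number makes the ultrafilter countably incomplete: the second
   projection is unbounded along it. *)
move=> finT; pose I := (seq {classic ld Sg 0} * nat)%type.
pose B (i : I) := [set j : I | {subset i.1 <= j.1} /\ i.2 <= j.2].
have FF : ProperFilter (filter_from setT B).
  apply: filter_from_proper; last by move=> i _; exists i; split.
  apply: filter_from_filter; first by exists ([::], 0).
  move=> [l m] [l' m'] _ _; exists (l ++ l', maxn m m') => // -[l'' m''] [] /= sub.
  rewrite geq_max => /andP[lem lem']; split; split=> //= x xl; apply: sub;
    by rewrite mem_cat xl ?orbT.
have [U [FU sU]] := ultraFilterLemma FF.
have /choice[N NP] : forall i : I, exists N : structure Sg,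
    forall phi, phi \in i.1 -> T phi -> ld_sat A phi (@no_vars N).
  (* Indices range over all lists, so sentences outside of [T] are filtered away first. *)
  move=> [l m]; have [|N NP] := finT [seq phi <- l | `[< T phi >]].
    by move=> phi; rewrite /= mem_filter => /andP[/asboolP].
  by exists N => phi lphi Tphi; apply: NP; rewrite mem_filter lphi andbT; apply/asboolP.
exists (ultraproduct U N) => phi Tphi.
have kappaP n : U [set i : I | n <= i.2].
  by apply: sU; exists ([::], n) => // i [].
apply: (ld_ultraproduct_sentence FU kappaP).
apply: sU; exists ([:: phi], 0) => // i [/(_ phi)].
by rewrite inE eqxx => /(_ erefl) iphi _; apply: NP.
Qed.
End RobinsonConsistency.

Theorem theorem10 (A : set (nat -> bool)) (Sg : signature)
    (tau1 tau2 : vocabulary Sg) (T1 T2 : set (ld Sg 0))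
    (A_codense : cantor_dense (~` A))
    (T1_theory : is_theory tau1 T1) (T2_theory : is_theory tau2 T2)
    (T1_consistent : consistent A T1) (T2_consistent : consistent A T2)
    (T12_complete : fo_complete A (vocI tau1 tau2) (T1 `&` T2)) :
  consistent A (T1 `|` T2).
Proof.
have [[M1 M1T] [M2 M2T]] := (T1_consistent, T2_consistent).
have M1I : models A M1 (T1 `&` T2) by move=> phi [/M1T].
have M2I : models A M2 (T1 `&` T2) by move=> phi [_ /M2T].
apply: compactness => // l lT.
(* Both models satisfy the common part of the theories, whose completeness decides [phi] in the same
   way for each. *)
have M12 (phi : fo Sg 0) : fo_in (vocI tau1 tau2) phi ->
    (fo_sat (@no_vars M1) phi <-> fo_sat (@no_vars M2) phi).
  by move=> /T12_complete[] E; have /= := (E M1 M1I, E M2 M2I); tauto.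
have [||N NP] := joint_fragment A_codense (l1 := [seq phi <- l | `[< T1 phi >]])
  (l2 := [seq phi <- l | `[< T2 phi >]]) M12.
- by move=> phi; rewrite mem_filter => /andP[/asboolP Tphi _]; split; [apply: T1_theory|apply: M1T].
- by move=> phi; rewrite mem_filter => /andP[/asboolP Tphi _]; split; [apply: T2_theory|apply: M2T].
exists N => phi lphi; apply: NP; rewrite !mem_filter lphi !andbT.
by case: (lT phi lphi) => T; [left|right]; apply/asboolP.
Qed.
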